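(* Fix a recommendation $\boldsymbol{x}\in\mathcal{X}$ and define $$STT_{\mathrm{SO}}:=\min_{\boldsymbol{z}}\left\{\mathbb{E}[g(\boldsymbol{Q}(\boldsymbol{x}),\boldsymbol{z})]:\ \mathbb{E}[h_j(\boldsymbol{Q}(\boldsymbol{x}),\boldsymbol{z})]\le0\ \ \forall j\in\mathcal{J}\right\},$$ $$STT_{\mathrm{EP}}(\boldsymbol{\epsilon}):=\min_{\boldsymbol{z},\boldsymbol{q}}\left\{g(\boldsymbol{q},\boldsymbol{z}):\ h_j(\boldsymbol{q},\boldsymbol{z})\le0\ \ \forall j\in\mathcal{J},\ \ |\boldsymbol{q}-\mathbb{E}[\boldsymbol{Q}(\boldsymbol{x})]|\le\boldsymbol{\epsilon}\right\}.$$ If $\boldsymbol{\epsilon}=0$ and $g$ and all $h_j$, $j\in\mathcal{J}$, are convex functions, then $$STT_{\mathrm{EP}}(\boldsymbol{\epsilon}=0)\le STT_{\mathrm{SO}} .$$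
   Context: $\boldsymbol{Q}(\boldsymbol{x})=(Q_t^{u,v,r}(\boldsymbol{x}))_{t\in\mathcal{T},(u,v,r)\in\mathcal{F}}$ is the random vector of path flows, which takes finitely many values: $\mathcal{T}$ is a finite set of time indices; $\mathcal{F}$ is the finite set of triplets $(u,v,r)$ with $(u,v)$ an origin-destination pair and $r$ in its finite path set $\mathcal{R}^{u,v}$; $\mathcal{P}$ is a finite set of passengers with path sets $\mathcal{R}_p$, and $\mathcal{P}_t^{u,v}\subseteq\mathcal{P}$ those with pair $(u,v)$ and departure time $t$ (for which $\mathcal{R}_p=\mathcal{R}^{u,v}$); $\mathcal{X}=\{\boldsymbol{x}:\ x_{p,r}\in\{0,1\},\ \sum_{r\in\mathcal{R}_p}x_{p,r}=1\ \forall p\in\mathcal{P}\}$; and $Q_t^{u,v,r}(\boldsymbol{x})=\sum_{p\in\mathcal{P}_t^{u,v}}\sum_{r'\in\mathcal{R}^{u,v}}x_{p,r'}\mathbb{1}_{p,r'}^r$, where $\mathbb{1}_{p,r'}^r$ is the Bernoulli indicator that $p$ chooses $r$ when recommended $r'$. The functions $g$ and $h_j$ ($j\in\mathcal{J}$, a set of constraint indices) are the real-valued objective and constraint functions, with arguments a path flow vector $\boldsymbol{q}$ and a decision vector $\boldsymbol{z}$, of an inner minimization problem written in the general format $\min_{\boldsymbol{z}}\{g(\boldsymbol{Q}(\boldsymbol{x}),\boldsymbol{z}):\ h_j(\boldsymbol{Q}(\boldsymbol{x}),\boldsymbol{z})\le0\ \forall j\in\mathcal{J}\}$ (in the application, $g$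 is the total waiting plus in-vehicle time of a transit network with onboard flows $\boldsymbol{z}$, and the $h_j$ encode its network-loading constraints). Convexity means convexity in $(\boldsymbol{q},\boldsymbol{z})$. Expectations are over $\boldsymbol{Q}(\boldsymbol{x})$. Absolute values and inequalities of vectors are componentwise. *)

(* Defs.v *)
From mathcomp Require Import all_boot all_order all_algebra.
From mathcomp Require Import all_classical all_reals all_analysis.

Set Implicit Arguments.
Unset Strict Implicit.
Unset Printing Implicit Defensive.

Import Order.TTheory GRing.Theory Num.Theory.
Local Open Scope classical_set_scope.
Local Open Scope ring_scope.

Record network := Network {
  time : finType;
  node : finType;
  route : finType;
  od_pairs : {set node * node};
  routes : node * node -> {set route};
  passenger : finType;
  pair_of : passenger -> node * node;
  pair_ofP : forall p, pair_of p \in od_pairs;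
  departure : passenger -> time
}.

(* The path set R_p of a passenger is that of the passenger's OD pair. *)
Definition passenger_routes (N : network) (p : passenger N) :
    {set route N} := routes (pair_of p).

(* The set of triplets (u, v, r), encoded as ((u, v), r). *)
Definition triplet (N : network) : finType :=
  {f : (node N * node N) * route N
     | (f.1 \in od_pairs N) && (f.2 \in routes f.1)}.

(* Vectors (q_t^{u,v,r}); R^o gives {ffun _ -> _} its R-module structure. *)
Definition flow (R : realType) (N : network) :=
  {ffun time N * triplet N -> R^o}.

(* The set X. Entries x p r with r outside R_p are unconstrained: they do not
   exist on paper and are never used below. *)
Definition recommendations (R : realType) (N : network) :
    set (passenger N -> route N -> R) :=
  [set x | forall p : passenger N,
     (forall r, r \in passenger_routes p -> x p r = 0 \/ x p r = 1) /\
     \sum_(r in passenger_routes p) x p r = 1].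
Arguments recommendations : clear implicits.

(* [chooses p r' r] is the event that p chooses r when recommended r'; its
   indicator is the Bernoulli variable 1_{p,r'}^r. *)
Definition path_flow (R : realType) (N : network) (T : Type)
    (chooses : passenger N -> route N -> route N -> set T)
    (x : passenger N -> route N -> R) (w : T) : flow R N :=
  [ffun k : time N * triplet N =>
     let: (uv, r) := val k.2 in
     \sum_(p : passenger N | (pair_of p == uv) && (departure p == k.1))
       \sum_(r' in routes uv) x p r' * \1_(chooses p r' r) w].

Section problems.
Local Open Scope ereal_scope.
Context (R : realType) (N : network) (d : measure_display)
  (T : measurableType d) (P : probability T R) (Q : T -> flow R N)
  (n : nat) (J : Type) (g : flow R N * 'rV[R]_n -> R)
  (h : J -> flow R N * 'rV[R]_n -> R).

(* Optimal values are infima in \bar R: they agree with the minima whenever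
   these are attained, and are +oo for an infeasible problem. *)
Definition STT_SO : \bar R :=
  ereal_inf [set 'E_P[fun w => g (Q w, z)]
            | z in [set z : 'rV[R]_n |
                    forall j, 'E_P[fun w => h j (Q w, z)] <= 0]].

Definition STT_EP (eps : flow R N) : \bar R :=
  ereal_inf [set (g qz)%:E
            | qz in [set qz : flow R N * 'rV[R]_n |
                     (forall j, (h j qz <= 0)%R) /\
                     (forall k, `|(qz.1 k : R)%:E - 'E_P[fun w => Q w k]|
                                <= (eps k : R)%:E)]].

End problems.

(* Main.v *)
Require Import Defs.
From mathcomp Require Import all_boot all_order all_algebra.
From mathcomp Require Import all_classical all_reals all_analysis.
Import Order.TTheory GRing.Theory Num.Theory.
Local Open Scope classical_set_scope.
Local Open Scope ring_scope.

(** The inequality is Jensen's, applied once to the objective and once to each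
    constraint.  If [z] is feasible for the stochastic problem, then
    [(E[Q], z)] is feasible for the problem at the expected flow: the distance
    constraint with zero tolerance holds as an equality, and
    [h j (E[Q], z) <= E[h j (Q, z)] <= 0] because [h j] is jointly convex and
    [z] is a constant.  Likewise [g (E[Q], z) <= E[g (Q, z)]], so every value
    of the stochastic problem dominates a value of the other one.

    Measurability and integrability of [g (Q, z)] and [h j (Q, z)] come from
    the finiteness of the randomness.  The flow is a function of the
    finite table recording which passenger chooses which route under which
    recommendation ([path_flow_outcome]), and every value of this table is
    taken on a measurable event ([measurable_outcome_of]).  Any function of
    the table then has its expectation given by a finite weighted sum
    ([expectation_finite_outcomes]), and Jensen's inequality becomes the
    finite one, [convex_function_sum]. *)

(** * Finite convex combinations *)

(** Induction on the number of terms needs weights of arbitrary total, since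
    removing a term breaks normalization.  Asserting that a barycenter [b]
    exists, instead of dividing by the total, leaves it free when the total
    is zero. *)
Lemma convex_function_barycenter (R : numFieldType) (E : lmodType R)
    (f : E -> R) (I : Type) (r : seq I) (p : I -> R) (y : I -> E) :
  convex_function [set: E] f -> (forall i, 0 <= p i) ->
  exists2 b : E, \sum_(i <- r) p i *: y i = (\sum_(i <- r) p i) *: b
    & (\sum_(i <- r) p i) * f b <= \sum_(i <- r) p i * f (y i).
Proof.
move=> fconvex p_ge0; elim: r => [|i r [b bE fb]].
  by exists 0; rewrite !big_nil ?scale0r ?mul0r.
rewrite !big_cons bE; have p0 := p_ge0 i.
have : 0 <= \sum_(j <- r) p j by exact: sumr_ge0.
move: (\sum_(j <- r) p j) fb => s fb s0.
(* zero total weight: any point is a barycenter, so [b] can be kept *)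
have [/eqP|ps_neq0] := eqVneq (p i + s) 0.
  rewrite paddr_eq0// => /andP[/eqP-> /eqP sE]; exists b.
    by rewrite sE addr0 !scale0r addr0.
  by rewrite mul0r !add0r.
have ps_gt0 : 0 < p i + s by rewrite lt_def ps_neq0 addr_ge0.
have t0 : 0 <= p i / (p i + s) by rewrite divr_ge0// ltW.
have t1 : p i / (p i + s) <= 1 by rewrite ler_pdivrMr// mul1r lerDl.
have tC : unstable.onem (p i / (p i + s)) = s / (p i + s).
  by rewrite /unstable.onem -[X in X - _](divff ps_neq0) -mulrBl addrAC subrr add0r.
exists ((p i / (p i + s)) *: y i + (s / (p i + s)) *: b).
  by rewrite scalerDr !scalerA !(mulrC (p i + s)) !divfK.
have := fconvex (Itv01 t0 t1) (y i) b (in_setT _) (in_setT _).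
rewrite convRE {1}/conv/= tC => /(ler_wpM2l (ltW ps_gt0)) /le_trans; apply.
rewrite mulrDr /GRing.scale/= !mulrA !(mulrC (p i + s)) !mulfK//.
by rewrite lerD2l.
Qed.

Lemma convex_function_sum (R : numFieldType) (E : lmodType R)
    (f : E -> R) (I : finType) (p : I -> R) (y : I -> E) :
  convex_function [set: E] f -> (forall i, 0 <= p i) -> \sum_i p i = 1 ->
  f (\sum_i p i *: y i) <= \sum_i p i * f (y i).
Proof.
move=> fconvex p_ge0 p1.
have [b] := @convex_function_barycenter _ _ _ _ (index_enum I) p y fconvex p_ge0.
by rewrite p1 scale1r mul1r => ->.
Qed.

Lemma sum_scaler_pairl (R : pzRingType) (V W : lmodType R) (I : finType)
    (p : I -> R) (v : I -> V) (w : W) : \sum_i p i = 1 ->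
  \sum_i p i *: (v i, w) = (\sum_i p i *: v i, w).
Proof.
move=> p1; apply: injective_projections => /=.
  by rewrite (raddf_sum (fst : V * W -> V)).
by rewrite (raddf_sum (snd : V * W -> W))/= -scaler_suml p1 scale1r.
Qed.

(** * Expectations over finitely many outcomes *)

Section finitely_many_outcomes.
Context {R : realType} {d : measure_display} {T : measurableType d}
  (P : probability T R) {I : finType} {B : T -> I}
  (mB : forall i, measurable (B @^-1` [set i])).

Let p i := fine (P (B @^-1` [set i])).

(** [F \o B] is the simple function that weighs the indicator of each level
    set of [B] by the value of [F] there. *)
Lemma expectation_finite_outcomes (F : I -> R) :
  ('E_P[F \o B] = (\sum_i p i * F i)%:E)%E.
Proof.
have indicL1 i : (\1_(B @^-1` [set i]) : T -> R) \in Lfun P 1.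
  by apply/Lfun1_integrable; exact: integrable_indic.
pose X i : T -> R := F i \o* \1_(B @^-1` [set i]).
have -> : F \o B = \sum_(Y <- [seq X i | i <- index_enum I]) Y.
  apply/funext => w /=; rewrite big_map fct_sumE (bigD1 (B w))//= big1 => [|i iB].
    by rewrite /X/= indicE mem_set// mul1r addr0.
  rewrite /X/= indicE memNset ?mul0r//= => Bwi.
  by rewrite Bwi eqxx in iB.
rewrite expectation_sum => [|_ /mapP[i _ ->]]; last exact: Lfun_scale.
rewrite big_map -sumEFin; apply: eq_bigr => i _.
rewrite expectationZl// expectation_indic// EFinM fineK ?fin_num_measure//.
exact: muleC.
Qed.

Lemma sum_outcome_probability : \sum_i p i = 1.
Proof.
have := expectation_finite_outcomes (fun=> 1).
rewrite (_ : _ \o _ = cst 1)// expectation_cst => -[->].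
by apply: eq_bigr => i _; rewrite mulr1.
Qed.

Lemma jensen_finite_outcomes {E : lmodType R} {f : E -> R} (y : I -> E) :
  convex_function [set: E] f ->
  ((f (\sum_i p i *: y i))%:E <= 'E_P[fun w => f (y (B w))])%E.
Proof.
move=> fconvex; rewrite (expectation_finite_outcomes (f \o y)) lee_fin.
apply: convex_function_sum => //; last exact: sum_outcome_probability.
by move=> i; exact: fine_ge0.
Qed.

End finitely_many_outcomes.

Lemma measurable_ffun_preimage (d : measure_display) (T : measurableType d)
    (K : finType) (B : T -> {ffun K -> bool}) (b : {ffun K -> bool}) :
  (forall k, measurable [set w | B w k]) -> measurable (B @^-1` [set b]).
Proof.
move=> mB.
have -> : B @^-1` [set b] = \bigcap_(k in [set: K]) [set w | B w k = b k].
  apply/seteqP; split => [w /= <- //|w Bw].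
  by apply/ffunP => k; exact: Bw.
apply: fin_bigcap_measurable => // k _.
case: (b k); first exact: mB.
have -> : [set w | B w k = false] = ~` [set w | B w k].
  by apply/seteqP; split => w /= => [->|/negP/negbTE].
exact: measurableC.
Qed.

(** * Path flows as functions of a finite table of choices *)

Section outcomes.
Context {R : realType} {N : network}.

(** The table of answers to: does [p] choose [r] when recommended [r']? *)
Definition outcome := {ffun passenger N * route N * route N -> bool}.

(** The choice events on the space of tables itself, so that [path_flow] can
    be evaluated at a table with the same formula as on the sample space. *)
Definition outcome_chooses (p : passenger N) (r' r : route N) : set outcome :=
  [set b : outcome | b (p, r', r)].

Context {T : Type} (chooses : passenger N -> route N -> route N -> set T).

(** Answers about routes outside the passenger's path set are forced to be
    negative, so that each entry is read off a measurable set; a path flow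
    only reads the entries within path sets. *)
Definition outcome_of (w : T) : outcome :=
  [ffun k : passenger N * route N * route N =>
    [&& k.1.2 \in passenger_routes k.1.1, k.2 \in passenger_routes k.1.1
      & w \in chooses k.1.1 k.1.2 k.2]].

Lemma path_flow_outcome (x : passenger N -> route N -> R) (w : T) :
  path_flow chooses x w = path_flow outcome_chooses x (outcome_of w).
Proof.
apply/ffunP => k; rewrite !ffunE; have := valP k.2.
case: (val k.2) => uv r /= /andP[_ r_uv].
apply: eq_bigr => p /andP[/eqP p_uv _]; apply: eq_bigr => r' r'_uv.
congr (_ * _); rewrite !indicE; congr (_ %:R); congr nat_of_bool.
by apply/idP/idP; rewrite !in_setE /outcome_chooses/= ffunE/=
  /passenger_routes p_uv r_uv r'_uv/= in_setE.
Qed.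

End outcomes.

Lemma measurable_outcome_of (N : network) (d : measure_display)
    (T : measurableType d)
    (chooses : passenger N -> route N -> route N -> set T) :
  (forall (p : passenger N) (r' r : route N),
     r' \in passenger_routes p -> r \in passenger_routes p ->
     measurable (chooses p r' r)) ->
  forall b, measurable (outcome_of chooses @^-1` [set b]).
Proof.
move=> mchooses b; apply: measurable_ffun_preimage => -[[p r'] r].
have [r'p|r'p] := boolP (r' \in passenger_routes p); last first.
  rewrite (_ : [set _ | _] = set0)//; apply/seteqP; split => // w /=.
  by rewrite ffunE/= (negbTE r'p).
have [rp|rp] := boolP (r \in passenger_routes p); last first.
  rewrite (_ : [set _ | _] = set0)//; apply/seteqP; split => // w /=.
  by rewrite ffunE/= (negbTE rp) andbF.
rewrite (_ : [set _ | _] = chooses p r' r); first exact: mchooses.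
by apply/seteqP; split => w /=; rewrite ffunE/= r'p rp/= in_setE.
Qed.

Theorem proposition3 (R : realType) (N : network)
  (d : measure_display) (T : measurableType d) (P : probability T R)
  (chooses : passenger N -> route N -> route N -> set T)
  (chooses_meas : forall (p : passenger N) (r' r : route N),
     r' \in passenger_routes p -> r \in passenger_routes p ->
     measurable (chooses p r' r))
  (x : passenger N -> route N -> R) (xX : x \in recommendations R N)
  (n : nat) (J : Type)
  (g : flow R N * 'rV[R]_n -> R) (h : J -> flow R N * 'rV[R]_n -> R)
  (g_convex : convex_function [set: flow R N * 'rV[R]_n] g)
  (h_convex : forall j : J,
     convex_function [set: flow R N * 'rV[R]_n] (h j))
  (eps : flow R N) (eps0 : eps = 0) :
  (STT_EP P (path_flow chooses x) g h eps
     <= STT_SO P (path_flow chooses x) g h)%E.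
Proof.
have mB := @measurable_outcome_of N d T chooses chooses_meas.
have -> : path_flow chooses x =
    path_flow outcome_chooses x \o outcome_of chooses :> (T -> flow R N).
  by apply/funext => w; exact: path_flow_outcome.
set q := path_flow outcome_chooses x; set B := outcome_of chooses in mB *.
pose p b := fine (P (B @^-1` [set b])).
(* [\sum_b p b *: q b] is the expected flow *)
have pointwise_jensen (f : flow R N * 'rV[R]_n -> R) z :
    convex_function [set: flow R N * 'rV[R]_n] f ->
    ((f (\sum_b p b *: q b, z))%:E <= 'E_P[fun w => f ((q \o B) w, z)])%E.
  move=> /(jensen_finite_outcomes P mB (fun b => (q b, z))).
  by rewrite sum_scaler_pairl//; exact: sum_outcome_probability.
apply/ereal_infP => _ [z zh <-].
apply: ge_ereal_inf; exists (g (\sum_b p b *: q b, z))%:E; last first.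
  exact: pointwise_jensen.
exists (\sum_b p b *: q b, z) => //; split => [j|k].
  by rewrite -lee_fin; apply: le_trans (zh j); exact: pointwise_jensen.
rewrite (expectation_finite_outcomes P mB (fun b => q b k : R)) eps0 ffunE.
rewrite sum_ffunE (_ : \sum_b _ = \sum_b p b * (q b k : R)).
  by rewrite subee// abse0.
by apply: eq_bigr => b _; rewrite ffunE.
Qed.
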